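(* For every $\beta\ge0$ there exists a function $f\in\mathcal{S}$ such that $C_\beta[f]\notin\mathcal{S}$.
   Context: $\mathbb{D}$ is the open unit disk; $\mathcal{A}$ the class of analytic $f$ on $\mathbb{D}$ with $f(0)=0$, $f'(0)=1$; $\mathcal{S}\subset\mathcal{A}$ the univalent functions. For $\beta\ge0$ and $f$ analytic on $\mathbb{D}$ with $f(0)=0$, $C_\beta[f](z)=\int_0^z \frac{f(w)}{w(1-w)^\beta}\,dw$ (principal branch of $(1-w)^\beta$). *)

(* Defs.v *)
From Stdlib Require Import Reals.
From Coquelicot Require Import Coquelicot.
Open Scope R_scope.

Definition in_disk (z : C) : Prop := Cmod z < 1.

Definition analytic_on_disk (f : C -> C) : Prop :=
  forall z : C, in_disk z -> ex_derive (K := C_AbsRing) (V := C_NormedModule) f z.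

Definition classA (f : C -> C) : Prop :=
  analytic_on_disk f /\ f (RtoC 0) = RtoC 0 /\
  is_derive (K := C_AbsRing) (V := C_NormedModule) f (RtoC 0) (RtoC 1).

Definition classS (f : C -> C) : Prop :=
  classA f /\ (forall z w : C, in_disk z -> in_disk w -> f z = f w -> z = w).

(* Principal branch of u^b for u with Re u > 0 (the only case used:
   u = 1 - w with w in D).  There Arg u = atan (Im u / Re u), so
   u^b = exp(b Log u) = |u|^b (cos (b Arg u) + i sin (b Arg u)). *)
Definition cpow_pr (u : C) (b : R) : C :=
  let r := Rpower (Cmod u) b in
  let th := atan (Im u / Re u) in
  (r * cos (b * th), r * sin (b * th)).

Definition Cbeta_integrand (beta : R) (f : C -> C) (w : C) : C :=
  (f w / (w * cpow_pr (1 - w) beta))%C.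

(* C_beta[f](z) = \int_0^z f(w)/(w(1-w)^beta) dw, integrated along the
   segment w = t z, t in [0,1]:  \int_0^1 g(t z) z dt. *)
Definition Cbeta (beta : R) (f : C -> C) (z : C) : C :=
  RInt (V := C_R_CompleteNormedModule)
       (fun t : R => (Cbeta_integrand beta f (RtoC t * z) * z)%C) 0 1.

(* Main.v *)
Require Import Defs.
From Stdlib Require Import Reals Lra.
From Coquelicot Require Import Coquelicot.
Open Scope R_scope.

(** The same spirallike function [f(z) = z (1 + z)^(i - 1)] works for every [beta].

    Univalence: if [f z = f w] and [rho = log(1 + z) - log(1 + w) = x + iy], then
    [z (e^(i rho) - 1) = 1 - e^rho] and, symmetrically,
    [w (e^(-i rho) - 1) = 1 - e^(-rho)]. If [rho <> 0], then [|z|, |w| < 1] gives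
    [e^|x + y| (cosh x - cos y) < cosh y - cos x], which is impossible for [|y| <= PI]: the
    nontrivial case [0 <= x < y] amounts to [e^y cos y - e^x cos x <= sinh (y - x)], and
    [e^t cos t] is concave on [[0, PI]] with slope [1] at [0].

    Non-univalence: [F = C_beta[f]] has [F'(z) = (1 + z)^(i - 1) (1 - z)^(-beta)]. In the
    coordinate [L = log(1 + z)] this reads [dF/dL = e^(iL) (2 - e^L)^(-beta)], which is
    exponentially close to the [2 PI]-periodic function [2^(-beta) e^(iL)] as [Re L] tends to
    [-oo]. Hence, for large [N], the point [-2 PI N] can be moved slightly to a point where [F]
    takes the same value as at [-2 PI (N + 1)]. *)

(** * Complex derivatives, exponential and logarithm *)

(** Values are taken in [C] as a module over itself, the form that the product rule requires;
    [is_derive_Cder] connects it with the structure used in [classA]. *)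
Definition Cder (f : C -> C) (z l : C) : Prop :=
  is_derive (K := C_AbsRing) (V := AbsRing_NormedModule C_AbsRing) f z l.

Lemma Cder_eps (f : C -> C) (z l : C) :
  Cder f z l <->
  forall eps : posreal, exists d : posreal, forall y : C,
    Cmod (y - z)%C < d ->
    Cmod ((f y - f z) - (y - z) * l)%C <= eps * Cmod (y - z)%C.
Proof.
  split.
  - intros [_ H] eps.
    destruct (H z (fun P HP => HP) eps) as [d Hd].
    exists d. intros y Hy. exact (Hd y Hy).
  - intros H. split.
    + exact (is_linear_scal_l (K := C_AbsRing)
        (V := AbsRing_NormedModule C_AbsRing) l).
    + intros x Hx eps.
      apply (is_filter_lim_locally_unique (K := C_AbsRing)
        (V := AbsRing_NormedModule C_AbsRing)) in Hx.
      subst x. destruct (H eps) as [d Hd].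
      exists d. intros y Hy. exact (Hd y Hy).
Qed.

(** Both module structures on [C] have the modulus as norm, so both notions reduce to the same
    estimate [Cder_eps]. *)
Lemma is_derive_Cder (f : C -> C) (z l : C) :
  is_derive (K := C_AbsRing) (V := C_NormedModule) f z l <-> Cder f z l.
Proof.
  rewrite Cder_eps. split.
  - intros [_ H] eps.
    destruct (H z (fun P HP => HP) eps) as [d Hd].
    exists d. intros y Hy. exact (Hd y Hy).
  - intros H. split.
    + exact (is_linear_scal_l (K := C_AbsRing) (V := C_NormedModule) l).
    + intros x Hx eps.
      apply (is_filter_lim_locally_unique (K := C_AbsRing)
        (V := AbsRing_NormedModule C_AbsRing)) in Hx.
      subst x. destruct (H eps) as [d Hd].
      exists d. intros y Hy. exact (Hd y Hy).
Qed.

Lemma Cder_eq (f : C -> C) (z l l' : C) : Cder f z l -> l = l' -> Cder f z l'.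
Proof. now intros H <-. Qed.

Lemma Cder_const (c z : C) : Cder (fun _ => c) z 0.
Proof. exact (is_derive_const (K := C_AbsRing) (V := AbsRing_NormedModule C_AbsRing) c z). Qed.

Lemma Cder_id (z : C) : Cder (fun x => x) z 1.
Proof. exact (is_derive_id (K := C_AbsRing) z). Qed.

Lemma Cder_plus (f g : C -> C) (z l m : C) :
  Cder f z l -> Cder g z m -> Cder (fun x => f x + g x)%C z (l + m)%C.
Proof. exact (is_derive_plus (K := C_AbsRing) (V := AbsRing_NormedModule C_AbsRing) f g z l m). Qed.

Lemma Cder_minus (f g : C -> C) (z l m : C) :
  Cder f z l -> Cder g z m -> Cder (fun x => f x - g x)%C z (l - m)%C.
Proof. exact (is_derive_minus (K := C_AbsRing) (V := AbsRing_NormedModule C_AbsRing) f g z l m). Qed.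

Lemma Cder_mult (f g : C -> C) (z l m : C) :
  Cder f z l -> Cder g z m ->
  Cder (fun x => f x * g x)%C z (l * g z + f z * m)%C.
Proof.
  intros Hf Hg.
  exact (is_derive_mult (K := C_AbsRing) f g z l m Hf Hg Cmult_comm).
Qed.

Lemma Cder_comp (f g : C -> C) (z l m : C) :
  Cder f (g z) l -> Cder g z m -> Cder (fun x => f (g x)) z (m * l)%C.
Proof. exact (is_derive_comp (K := C_AbsRing) (V := AbsRing_NormedModule C_AbsRing) f g z l m). Qed.

Lemma Cder_local (f g : C -> C) (z l : C) (d : R) :
  0 < d -> (forall y, Cmod (y - z)%C < d -> f y = g y) -> Cder f z l -> Cder g z l.
Proof.
  intros Hd Hfg. rewrite !Cder_eps. intros H eps.
  destruct (H eps) as [e He].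
  exists (mkposreal (Rmin d e) (Rmin_pos _ _ Hd (cond_pos e))). simpl. intros y Hy.
  rewrite <- !Hfg.
  - apply He. eapply Rlt_le_trans; [exact Hy|apply Rmin_r].
  - replace (z - z)%C with (RtoC 0) by ring. rewrite Cmod_0. exact Hd.
  - eapply Rlt_le_trans; [exact Hy|apply Rmin_l].
Qed.

Lemma Cder_continuity (f : C -> C) (z l : C) :
  Cder f z l -> forall eps, 0 < eps -> exists d, 0 < d /\ forall y,
    Cmod (y - z)%C < d -> Cmod (f y - f z)%C < eps.
Proof.
  rewrite Cder_eps. intros H eps He.
  destruct (H (mkposreal 1 Rlt_0_1)) as [d Hd]. simpl in Hd.
  pose proof (Cmod_ge_0 l) as Hl.
  assert (Hq : 0 < eps / (2 + Cmod l)) by (apply Rdiv_lt_0_compat; lra).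
  exists (Rmin d (eps / (2 + Cmod l))).
  split; [apply Rmin_pos; [apply cond_pos|exact Hq]|].
  intros y Hy.
  assert (H1 := Hd y (Rlt_le_trans _ _ _ Hy (Rmin_l _ _))).
  assert (H2 := Rlt_le_trans _ _ _ Hy (Rmin_r _ _)).
  replace (f y - f z)%C with ((f y - f z - (y - z) * l) + (y - z) * l)%C by ring.
  eapply Rle_lt_trans; [apply Cmod_triangle|].
  rewrite Cmod_mult.
  apply (Rmult_lt_compat_r (2 + Cmod l)) in H2; [|lra].
  unfold Rdiv in H2. rewrite Rmult_assoc, Rinv_l, Rmult_1_r in H2 by lra.
  pose proof (Cmod_ge_0 (y - z)). nra.
Qed.

(** * The exponential and the principal logarithm *)

Definition Cexp (z : C) : C := (exp (Re z) * cos (Im z), exp (Re z) * sin (Im z)).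
(** This is the principal logarithm only on [0 < Re z], the half-plane that contains [1 + z] and
    [1 - z] for [z] in the disk; the argument is encoded as in [cpow_pr]. *)
Definition Clog (z : C) : C := (ln (Cmod z), atan (Im z / Re z)).

Lemma Cexp_plus (z w : C) : Cexp (z + w) = (Cexp z * Cexp w)%C.
Proof.
  destruct z as [a b], w as [c d]. unfold Cexp, Cmult, Cplus; simpl.
  rewrite exp_plus, cos_plus, sin_plus. f_equal; ring.
Qed.

Lemma Cexp_0 : Cexp 0 = 1%C.
Proof. unfold Cexp; simpl. rewrite exp_0, cos_0, sin_0. unfold RtoC. f_equal; ring. Qed.

Lemma Cmod_Cexp (z : C) : Cmod (Cexp z) = exp (Re z).
Proof.
  unfold Cmod, Cexp; simpl fst; simpl snd.
  replace ((exp (Re z) * cos (Im z)) ^ 2 + (exp (Re z) * sin (Im z)) ^ 2)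
    with (Rsqr (exp (Re z)) * (Rsqr (sin (Im z)) + Rsqr (cos (Im z)))) by (unfold Rsqr; ring).
  rewrite sin2_cos2, Rmult_1_r. apply sqrt_Rsqr, Rlt_le, exp_pos.
Qed.

Lemma Cexp_neq_0 (z : C) : Cexp z <> 0.
Proof. apply Cmod_gt_0. rewrite Cmod_Cexp. apply exp_pos. Qed.

Lemma Cexp_Clog (z : C) : 0 < Re z -> Cexp (Clog z) = z.
Proof.
  destruct z as [x y]. simpl. intros Hx. unfold Cexp, Clog; simpl.
  assert (Hm : Cmod (x, y) = x * sqrt (1 + (y / x)²)).
  { unfold Cmod; simpl fst; simpl snd.
    rewrite <- (sqrt_Rsqr x) at 2 by lra.
    rewrite <- sqrt_mult_alt by apply Rle_0_sqr.
    f_equal. unfold Rsqr. field. lra. }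
  assert (Hs : 0 < sqrt (1 + (y / x)²)).
  { apply sqrt_lt_R0. pose proof (Rle_0_sqr (y / x)). lra. }
  rewrite exp_ln by (rewrite Hm; nra).
  rewrite cos_atan, sin_atan, Hm. f_equal; field; lra.
Qed.

Lemma Clog_Cexp (z : C) : Rabs (Im z) < PI / 2 -> Clog (Cexp z) = z.
Proof.
  destruct z as [x y]. intros H. simpl in H. apply Rabs_def2 in H.
  unfold Clog. rewrite Cmod_Cexp, ln_exp. unfold Cexp; simpl. f_equal.
  replace (exp x * sin y / (exp x * cos y)) with (tan y).
  - apply atan_tan. lra.
  - assert (0 < cos y) by (apply cos_gt_0; lra). pose proof (exp_pos x).
    unfold tan. field. lra.
Qed.

Lemma Cmod_le_components (z : C) : Cmod z <= Rabs (Re z) + Rabs (Im z).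
Proof.
  destruct z as [x y]. unfold Cmod; simpl fst; simpl snd.
  change (Re (x, y)) with x. change (Im (x, y)) with y.
  pose proof (Rabs_pos x). pose proof (Rabs_pos y).
  rewrite <- (sqrt_Rsqr (Rabs x + Rabs y)) by lra.
  apply sqrt_le_1_alt.
  rewrite <- (pow2_abs x), <- (pow2_abs y). unfold Rsqr. nra.
Qed.

Lemma Rabs_Im_le_Cmod (z : C) : Rabs (Im z) <= Cmod z.
Proof. eapply Rle_trans; [apply Rmax_r|apply Rmax_Cmod]. Qed.

Lemma derivable_pt_lim_0_bound (g : R -> R) (l : R) :
  derivable_pt_lim g 0 l -> forall eps, 0 < eps -> exists d, 0 < d /\
    forall h, Rabs h < d -> Rabs (g h - g 0 - l * h) <= eps * Rabs h.
Proof.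
  intros H eps He. destruct (H eps He) as [d Hd].
  exists d. split; [apply cond_pos|]. intros h Hh.
  destruct (Req_dec h 0) as [->|Hn].
  - replace (g 0 - g 0 - l * 0) with 0 by ring. rewrite Rabs_R0. lra.
  - specialize (Hd h Hn Hh). rewrite Rplus_0_l in Hd.
    replace (g h - g 0 - l * h) with (((g h - g 0) / h - l) * h) by (field; exact Hn).
    rewrite Rabs_mult. apply Rmult_le_compat_r; [apply Rabs_pos|lra].
Qed.

(** For [h = x + iy], the error [e^h - 1 - h] has real part [(e^x - 1 - x) + e^x (cos y - 1)] and
    imaginary part [e^x (sin y - y) + (e^x - 1) y]; the real derivatives at 0 control every term. *)
Lemma Cder_Cexp_0 : Cder Cexp 0 1.
Proof.
  apply Cder_eps. intros eps.
  (* The bound [1/4] keeps [exp x <= 2]. The two components are then at most [3 e |h|] and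
     [4 e |h|], hence the divisor 8. *)
  set (e := Rmin (1/4) (eps / 8)).
  assert (He : 0 < e) by (apply Rmin_pos; [lra|pose proof (cond_pos eps); lra]).
  assert (He1 : e <= 1/4) by apply Rmin_l.
  assert (He2 : e <= eps / 8) by apply Rmin_r.
  destruct (derivable_pt_lim_0_bound _ _ (derivable_pt_lim_exp 0) e He) as [d1 [Hd1 E1]].
  destruct (derivable_pt_lim_0_bound _ _ (derivable_pt_lim_sin 0) e He) as [d2 [Hd2 E2]].
  destruct (derivable_pt_lim_0_bound _ _ (derivable_pt_lim_cos 0) e He) as [d3 [Hd3 E3]].
  assert (Hd : 0 < Rmin (Rmin d1 d2) (Rmin d3 e)) by (apply Rmin_pos; apply Rmin_pos; assumption).
  exists (mkposreal _ Hd). simpl. intros h.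
  replace (h - 0)%C with h by ring. intros Hh.
  rewrite Cexp_0.
  pose proof (Rmin_l (Rmin d1 d2) (Rmin d3 e)). pose proof (Rmin_r (Rmin d1 d2) (Rmin d3 e)).
  pose proof (Rmin_l d1 d2). pose proof (Rmin_r d1 d2).
  pose proof (Rmin_l d3 e). pose proof (Rmin_r d3 e).
  pose proof (re_le_Cmod h) as Hx. pose proof (Rabs_Im_le_Cmod h) as Hy.
  destruct h as [x y]. change (Re (x, y)) with x in Hx. change (Im (x, y)) with y in Hy.
  set (m := Cmod (x, y)) in *.
  specialize (E1 x ltac:(lra)). specialize (E2 y ltac:(lra)). specialize (E3 y ltac:(lra)).
  rewrite exp_0 in E1. rewrite sin_0, cos_0 in E2. rewrite sin_0, cos_0 in E3.
  replace (cos y - 1 - - 0 * y) with (cos y - 1) in E3 by ring.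
  replace (sin y - 0 - 1 * y) with (sin y - y) in E2 by ring.
  replace (exp x - 1 - 1 * x) with (exp x - 1 - x) in E1 by ring.
  pose proof (Rabs_pos x). pose proof (Rabs_pos y).
  assert (Hexp : 0 < exp x <= 2).
  { split; [apply exp_pos|]. apply Rabs_le_between in E1.
    pose proof (Rle_abs x). nra. }
  assert (Hexp1 : Rabs (exp x - 1) <= 2 * e).
  { replace (exp x - 1) with ((exp x - 1 - x) + x) by ring.
    eapply Rle_trans; [apply Rabs_triang|]. nra. }
  eapply Rle_trans; [apply Cmod_le_components|].
  unfold Cexp, Cmult, Cminus, Cplus, Copp, RtoC; simpl.
  replace (exp x * cos y + - (1) + - (x * 1 - y * 0))
    with ((exp x - 1 - x) + exp x * (cos y - 1)) by ring.
  replace (exp x * sin y + - 0 + - (x * 0 + y * 1))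
    with (exp x * (sin y - y) + (exp x - 1) * y) by ring.
  assert (A1 : Rabs ((exp x - 1 - x) + exp x * (cos y - 1)) <= e * m + 2 * (e * m)).
  { eapply Rle_trans; [apply Rabs_triang|]. rewrite Rabs_mult, (Rabs_pos_eq (exp x)) by lra.
    apply Rplus_le_compat; [nra|]. apply Rmult_le_compat; try lra; try apply Rabs_pos. nra. }
  assert (A2 : Rabs (exp x * (sin y - y) + (exp x - 1) * y) <= 2 * (e * m) + 2 * e * m).
  { eapply Rle_trans; [apply Rabs_triang|]. rewrite !Rabs_mult, (Rabs_pos_eq (exp x)) by lra.
    apply Rplus_le_compat; apply Rmult_le_compat; try lra; try apply Rabs_pos. nra. }
  nra.
Qed.

Lemma Cder_Cexp (z : C) : Cder Cexp z (Cexp z).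
Proof.
  assert (H : Cder (fun x => Cexp z * Cexp (x - z))%C z (Cexp z)).
  { eapply Cder_eq.
    - apply Cder_mult; [apply Cder_const|].
      apply (Cder_comp Cexp (fun x => x - z)%C z 1%C).
      + replace (z - z)%C with (RtoC 0) by ring. exact Cder_Cexp_0.
      + apply Cder_minus; [apply Cder_id|apply Cder_const].
    - cbv beta. ring. }
  revert H. apply (Cder_local _ _ _ _ 1 Rlt_0_1). intros y _.
  rewrite <- Cexp_plus. f_equal. ring.
Qed.

(** With [u = y - z] and [w = g y - g z], differentiability of [f] gives [|u - w l| <= e |w|].
    Taking [e <= |l|/2] forces [|w| |l| <= 2 |u|], and then [w - u/l = -(u - w l)/l] is at most
    [eps |u|] by the second bound on [e]. *)
Lemma Cder_inverse (f g : C -> C) (z l : C) (r : R) :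
  0 < r -> (forall y, Cmod (y - z)%C < r -> f (g y) = y) ->
  (forall eps, 0 < eps -> exists d, 0 < d /\ forall y,
     Cmod (y - z)%C < d -> Cmod (g y - g z)%C < eps) ->
  Cder f (g z) l -> l <> 0 -> Cder g z (/ l)%C.
Proof.
  intros Hr Hfg Hg Hf Hl. apply Cder_eps. intros eps.
  assert (Hm : 0 < Cmod l) by now apply Cmod_gt_0.
  pose proof (cond_pos eps) as Heps.
  set (e := Rmin (Cmod l / 2) (eps * (Cmod l * Cmod l / 2))).
  assert (He : 0 < e).
  { apply Rmin_pos; [lra|]. apply Rmult_lt_0_compat; nra. }
  assert (He1 : e <= Cmod l / 2) by apply Rmin_l.
  assert (He2 : e <= eps * (Cmod l * Cmod l / 2)) by apply Rmin_r.
  rewrite Cder_eps in Hf.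
  destruct (Hf (mkposreal e He)) as [d Hd]. simpl in Hd.
  destruct (Hg d (cond_pos d)) as [d' [Hd' Hg']].
  exists (mkposreal (Rmin d' r) (Rmin_pos _ _ Hd' Hr)). simpl. intros y Hy.
  assert (Hy1 := Rlt_le_trans _ _ _ Hy (Rmin_l _ _)).
  assert (Hy2 := Rlt_le_trans _ _ _ Hy (Rmin_r _ _)).
  specialize (Hd (g y) (Hg' y Hy1)).
  rewrite (Hfg y Hy2), (Hfg z) in Hd
    by (replace (z - z)%C with (RtoC 0) by ring; rewrite Cmod_0; exact Hr).
  set (u := (y - z)%C) in *. set (w := (g y - g z)%C) in *.
  assert (Hw : Cmod w * Cmod l <= 2 * Cmod u).
  { rewrite <- Cmod_mult.
    assert (Cmod (w * l) <= Cmod u + Cmod (u - w * l)).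
    { rewrite <- (Cmod_opp (u - w * l)).
      replace (w * l)%C with (u + - (u - w * l))%C at 1 by ring. apply Cmod_triangle. }
    rewrite Cmod_mult in *. pose proof (Cmod_ge_0 w). nra. }
  replace (w - u * / l)%C with (- ((u - w * l) / l))%C by (field; exact Hl).
  rewrite Cmod_opp, Cmod_div by exact Hl.
  apply Rle_div_l; [exact Hm|].
  eapply Rle_trans; [exact Hd|].
  pose proof (Cmod_ge_0 w). pose proof (Cmod_ge_0 u). 
  assert (e * Cmod w <= eps * (Cmod l * Cmod l / 2) * Cmod w) by (apply Rmult_le_compat_r; lra).
  assert (eps * (Cmod l / 2) * (Cmod w * Cmod l) <= eps * (Cmod l / 2) * (2 * Cmod u)).
  { apply Rmult_le_compat_l; [|lra]. nra. }
  lra.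
Qed.

Lemma continuous_eps (f : C -> R) (z : C) :
  continuous (T := C_UniformSpace) (U := R_UniformSpace) f z ->
  forall eps, 0 < eps -> exists d, 0 < d /\ forall y,
     Cmod (y - z)%C < d -> Rabs (f y - f z) < eps.
Proof.
  intros H eps He.
  destruct (proj1 (filterlim_locally _ _) H (mkposreal eps He)) as [d Hd].
  exists d. split; [apply cond_pos|]. intros y Hy.
  apply (Hd y). apply C_NormedModule_mixin_compat1. exact Hy.
Qed.

Lemma continuous_Clog_re (z : C) :
  0 < Cmod z -> continuous (T := C_UniformSpace) (U := R_UniformSpace) (fun y => ln (Cmod y)) z.
Proof.
  intros H. apply (continuous_comp (U := C_UniformSpace) Cmod ln).
  - exact (filterlim_norm (K := C_AbsRing) (V := C_NormedModule) z).
  - apply continuous_ln. exact H.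
Qed.

Lemma continuous_Clog_im (z : C) :
  0 < Re z -> continuous (T := C_UniformSpace) (U := R_UniformSpace) (fun y => atan (Im y / Re y)) z.
Proof.
  intros H. apply (continuous_comp (U := C_UniformSpace) (fun y => Im y / Re y) atan).
  - apply (continuous_mult (U := C_UniformSpace) (K := R_AbsRing)).
    + exact (continuous_snd (fst z) (snd z)).
    + apply (continuous_comp (U := C_UniformSpace) Re Rinv).
      * exact (continuous_fst (fst z) (snd z)).
      * apply continuous_Rinv. lra.
  - apply continuous_atan.
Qed.

Lemma Re_pos_open (z : C) (y : C) : Cmod (y - z)%C < Re z -> 0 < Re y.
Proof.
  intros H. pose proof (re_le_Cmod (y - z)%C) as H1.
  apply Rabs_le_between in H1. unfold Re in *. simpl in H1. lra.
Qed.

Lemma Cder_Clog (z : C) : 0 < Re z -> Cder Clog z (/ z)%C.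
Proof.
  intros Hz.
  apply (Cder_inverse Cexp Clog z z (Re z) Hz).
  - intros y Hy. apply Cexp_Clog. now apply (Re_pos_open z).
  - intros eps He.
    assert (Hm : 0 < Cmod z).
    { pose proof (re_le_Cmod z). pose proof (Rle_abs (Re z)). lra. }
    destruct (continuous_eps _ _ (continuous_Clog_re z Hm) (eps / 2) ltac:(lra)) as [d1 [Hd1 E1]].
    destruct (continuous_eps _ _ (continuous_Clog_im z Hz) (eps / 2) ltac:(lra)) as [d2 [Hd2 E2]].
    exists (Rmin d1 d2). split; [now apply Rmin_pos|]. intros y Hy.
    specialize (E1 y (Rlt_le_trans _ _ _ Hy (Rmin_l _ _))).
    specialize (E2 y (Rlt_le_trans _ _ _ Hy (Rmin_r _ _))).
    eapply Rle_lt_trans; [apply Cmod_le_components|].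
    unfold Rminus in *; simpl in *. lra.
  - eapply Cder_eq; [apply Cder_Cexp|now apply Cexp_Clog].
  - intros ->. simpl in Hz. lra.
Qed.

Lemma cpow_pr_Cexp (u : C) (b : R) : cpow_pr u b = Cexp (b * Clog u).
Proof.
  unfold cpow_pr, Cexp, Clog, Rpower; simpl.
  rewrite !Rmult_0_l, Rminus_0_r, Rplus_0_r. reflexivity.
Qed.

Lemma Cder_Cpow (c u : C) :
  0 < Re u -> Cder (fun x => Cexp (c * Clog x))%C u (c * Cexp (c * Clog u) / u)%C.
Proof.
  intros Hu. eapply Cder_eq.
  - apply (Cder_comp Cexp (fun x => c * Clog x)%C); [apply Cder_Cexp|].
    apply Cder_mult; [apply Cder_const|now apply Cder_Clog].
  - cbv beta. unfold Cdiv. ring.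
Qed.

(** * Univalence of the spirallike function *)

Lemma le_of_derive_nonneg (f df : R -> R) (a b : R) :
  a <= b -> (forall x, a <= x <= b -> is_derive f x (df x)) ->
  (forall x, a <= x <= b -> 0 <= df x) -> f a <= f b.
Proof.
  intros Hab Hd Hp.
  destruct (MVT_gen f a b df) as [c [Hc E]];
    rewrite ?(Rmin_left a b), ?(Rmax_right a b) in * by lra.
  - intros x Hx. apply Hd. lra.
  - intros x Hx. apply derivable_continuous_pt. exists (df x).
    apply is_derive_Reals, Hd, Hx.
  - specialize (Hp c Hc). nra.
Qed.

(** [t - e^t cos t] is nondecreasing: its derivative vanishes at 0 and has itself the derivative
    [2 e^t sin t], nonnegative on [[0, PI]]. *)
Lemma exp_cos_increment_le (x y : R) :
  0 <= x -> x <= y -> y <= PI -> exp y * cos y - exp x * cos x <= y - x.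
Proof.
  intros Hx Hxy Hy.
  enough (x - exp x * cos x <= y - exp y * cos y) by lra.
  apply (le_of_derive_nonneg (fun t => t - exp t * cos t)
           (fun t => 1 - exp t * (cos t - sin t))); [exact Hxy| |].
  - intros t _. auto_derive; [exact I|ring].
  - intros t Ht.
    assert (H : - (exp 0 * (cos 0 - sin 0)) <= - (exp t * (cos t - sin t))).
    { apply (le_of_derive_nonneg (fun s => - (exp s * (cos s - sin s)))
               (fun s => 2 * exp s * sin s)); [lra| |].
      - intros s _. auto_derive; [exact I|ring].
      - intros s Hs. pose proof (exp_pos s).
        assert (0 <= sin s) by (apply sin_ge_0; lra). nra. }
    rewrite exp_0, cos_0, sin_0 in H. lra.
Qed.

Lemma cosh_ge_1 (t : R) : 1 <= cosh t.
Proof.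
  unfold cosh. pose proof (exp_ineq1_le t). pose proof (exp_ineq1_le (- t)). lra.
Qed.

Lemma sinh_ge (t : R) : 0 <= t -> t <= sinh t.
Proof.
  intros Ht.
  enough (sinh 0 - 0 <= sinh t - t) by (rewrite sinh_0 in *; lra).
  apply (le_of_derive_nonneg (fun s => sinh s - s) (fun s => cosh s - 1)); [exact Ht| |].
  - intros s _. unfold sinh, cosh. auto_derive; [exact I|field].
  - intros s _. pose proof (cosh_ge_1 s). lra.
Qed.

(** The derivative is nonnegative because [sin s <= s <= sinh s]. *)
Lemma cosh_plus_cos_le (x y : R) :
  0 <= x -> x <= y -> cosh x + cos x <= cosh y + cos y.
Proof.
  intros Hx Hxy.
  apply (le_of_derive_nonneg (fun s => cosh s + cos s) (fun s => sinh s - sin s)); [exact Hxy| |].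
  - intros s _. unfold sinh, cosh. auto_derive; [exact I|field].
  - intros s Hs. pose proof (sinh_ge s ltac:(lra)).
    destruct (Req_dec s 0) as [->|].
    + rewrite sin_0, sinh_0. lra.
    + pose proof (sin_lt_x s ltac:(lra)). lra.
Qed.

(** After multiplication by [e^x], right side minus left side is
    [sinh (y - x) - (e^y cos y - e^x cos x)], and [y - x] lies between these two terms. *)
Lemma cosh_minus_cos_le_exp (x y : R) :
  0 <= x -> x <= y -> y <= PI ->
  cosh y - cos x <= exp (y - x) * (cosh x - cos y).
Proof.
  intros Hx Hxy Hy.
  pose proof (exp_cos_increment_le x y Hx Hxy Hy) as H1.
  pose proof (sinh_ge (y - x) ltac:(lra)) as H2.
  apply (Rmult_le_reg_l (exp x)); [apply exp_pos|].
  enough (0 <= exp x * (exp (y - x) * (cosh x - cos y)) - exp x * (cosh y - cos x)) by lra.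
  replace (exp x * (exp (y - x) * (cosh x - cos y)) - exp x * (cosh y - cos x))
    with (sinh (y - x) - (exp y * cos y - exp x * cos x)); [lra|].
  unfold sinh, cosh, Rminus. rewrite Ropp_plus_distr, Ropp_involutive, !exp_plus, !exp_Ropp.
  pose proof (exp_pos x). pose proof (exp_pos y). field. lra.
Qed.

Lemma cosh_Rabs (t : R) : cosh (Rabs t) = cosh t.
Proof.
  unfold Rabs. destruct (Rcase_abs t); [|reflexivity].
  unfold cosh. rewrite Ropp_involutive. field.
Qed.

Lemma cos_Rabs (t : R) : cos (Rabs t) = cos t.
Proof. unfold Rabs. destruct (Rcase_abs t); [apply cos_neg|reflexivity]. Qed.

(** If [|y| <= |x|], monotonicity of [cosh + cos] suffices, the exponential being at least 1.
    Otherwise [cosh_minus_cos_le_exp] applies to [|x|] and [|y|], with [|y| - |x| <= |x + y|]. *)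
Lemma cosh_minus_cos_swap (x y : R) :
  Rabs y <= PI -> cosh y - cos x <= exp (Rabs (x + y)) * (cosh x - cos y).
Proof.
  intros Hy.
  pose proof (cosh_ge_1 x). pose proof (COS_bound y).
  assert (H1 : 1 <= exp (Rabs (x + y))).
  { pose proof (exp_ineq1_le (Rabs (x + y))). pose proof (Rabs_pos (x + y)). lra. }
  destruct (Rle_dec (Rabs y) (Rabs x)) as [H2|H2].
  - pose proof (cosh_plus_cos_le _ _ (Rabs_pos y) H2) as H3.
    rewrite !cosh_Rabs, !cos_Rabs in H3. nra.
  - pose proof (cosh_minus_cos_le_exp (Rabs x) (Rabs y) (Rabs_pos x) ltac:(lra) Hy) as H3.
    rewrite !cosh_Rabs, !cos_Rabs in H3.
    eapply Rle_trans; [exact H3|]. apply Rmult_le_compat_r; [lra|].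
    destruct (Rle_lt_or_eq_dec (Rabs y - Rabs x) (Rabs (x + y))) as [E|E];
      [ | left; now apply exp_increasing | rewrite E; lra ].
    pose proof (Rabs_triang_inv y (- x)) as H4. rewrite Rabs_Ropp in H4.
    replace (y - - x) with (x + y) in H4 by ring. exact H4.
Qed.

Lemma Cmod2_Cexp_minus_1 (x y : R) :
  Cmod (Cexp (x, y) - 1)%C ^ 2 = 2 * exp x * (cosh x - cos y).
Proof.
  rewrite Cmod2_alt. unfold Cexp, Cminus, Cplus, Copp, RtoC; simpl.
  pose proof (sin2_cos2 y) as H. unfold Rsqr in H. pose proof (exp_pos x).
  unfold cosh. rewrite exp_Ropp.
  replace (2 * exp x * ((exp x + / exp x) / 2 - cos y))
    with (exp x * exp x * (sin y * sin y + cos y * cos y) + 1 - 2 * exp x * cos y)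
    by (rewrite H; field; lra).
  ring.
Qed.

(** Squaring turns the two inequalities into [e^(x+y) (cosh x - cos y) < cosh y - cos x] and the
    same with [e^(-(x+y))]. The one whose exponent is [|x + y|] contradicts
    [cosh_minus_cos_swap]. *)
Lemma rotate_exponent_not_both_larger (rho : C) :
  Rabs (Im rho) <= PI ->
  Cmod (Cexp rho - 1)%C < Cmod (Cexp (Ci * rho) - 1)%C ->
  Cmod (Cexp (- rho) - 1)%C < Cmod (Cexp (- (Ci * rho)) - 1)%C -> False.
Proof.
  destruct rho as [x y]. intros Hy H1 H2. change (Im (x, y)) with y in Hy.
  assert (Hsq : forall a b : C, Cmod a < Cmod b -> Cmod a ^ 2 < Cmod b ^ 2).
  { intros a b Hab. pose proof (Cmod_ge_0 a). nra. }
  apply Hsq in H1. apply Hsq in H2.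
  replace (Ci * (x, y))%C with (- y, x) in H1, H2
    by (unfold Ci, Cmult; simpl; f_equal; ring).
  rewrite !Cmod2_Cexp_minus_1 in H1.
  change (- (x, y))%C with ((- x)%R, (- y)%R) in H2.
  change (- ((- y)%R, x))%C with ((- - y)%R, (- x)%R) in H2.
  rewrite !Cmod2_Cexp_minus_1 in H2.
  rewrite Ropp_involutive, !cos_neg in H2.
  replace (cosh (- x)) with (cosh x) in H2 by (unfold cosh; rewrite Ropp_involutive; field).
  replace (cosh (- y)) with (cosh y) in H1 by (unfold cosh; rewrite Ropp_involutive; field).
  pose proof (cosh_minus_cos_swap x y Hy) as H.
  assert (K1 : exp (x + y) * (cosh x - cos y) < cosh y - cos x).
  { apply (Rmult_lt_reg_l (exp (- y))); [apply exp_pos|].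
    rewrite <- Rmult_assoc, <- exp_plus. replace (- y + (x + y)) with x by ring. lra. }
  assert (K2 : exp (- (x + y)) * (cosh x - cos y) < cosh y - cos x).
  { apply (Rmult_lt_reg_l (exp y)); [apply exp_pos|].
    rewrite <- Rmult_assoc, <- exp_plus. replace (y + - (x + y)) with (- x) by ring. lra. }
  unfold Rabs in H. destruct (Rcase_abs (x + y)); lra.
Qed.

(** * The spirallike function and its membership in the class S *)

Definition spiral (z : C) : C := (z * Cexp ((Ci - 1) * Clog (1 + z)))%C.

Lemma Re_one_plus_pos (z : C) : in_disk z -> 0 < Re (1 + z)%C.
Proof.
  unfold in_disk. intros H. apply (Re_pos_open 1). simpl.
  replace (1 + z - 1)%C with z by ring. exact H.
Qed.

Lemma Rabs_Im_Clog (z : C) : Rabs (Im (Clog z)) < PI / 2.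
Proof. simpl. pose proof (atan_bound (Im z / Re z)). apply Rabs_def1; lra. Qed.

(** Equality of the values reads [z e^(i rho) = w e^rho], and [(1 + w) e^rho = 1 + z] eliminates
    [w]. *)
Lemma spiral_eq_solve (z w : C) :
  in_disk z -> in_disk w -> spiral z = spiral w ->
  let rho := (Clog (1 + z) - Clog (1 + w))%C in
  (z * (Cexp (Ci * rho) - 1) = - (Cexp rho - 1))%C.
Proof.
  intros Hz Hw E rho.
  pose proof (Cexp_Clog _ (Re_one_plus_pos z Hz)) as E1.
  pose proof (Cexp_Clog _ (Re_one_plus_pos w Hw)) as E2.
  unfold spiral in E. unfold rho. clear rho.
  set (L := Clog (1 + z)) in *. set (M := Clog (1 + w)) in *.
  assert (E3 : (z * Cexp (Ci * (L - M)) = w * Cexp (L - M))%C).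
  { replace (Ci * (L - M))%C with ((Ci - 1) * L + (L - Ci * M))%C by ring.
    replace (L - M)%C with ((Ci - 1) * M + (L - Ci * M))%C by ring.
    rewrite !Cexp_plus, !Cmult_assoc, E. reflexivity. }
  assert (E4 : ((1 + w) * Cexp (L - M) = 1 + z)%C).
  { rewrite <- E2, <- Cexp_plus, <- E1. f_equal. ring. }
  replace (z * (Cexp (Ci * (L - M)) - 1))%C with (z * Cexp (Ci * (L - M)) - z)%C by ring.
  rewrite E3.
  replace (w * Cexp (L - M))%C with ((1 + w) * Cexp (L - M) - Cexp (L - M))%C by ring.
  rewrite E4. ring.
Qed.

Lemma spiral_injective (z w : C) :
  in_disk z -> in_disk w -> spiral z = spiral w -> z = w.
Proof.
  intros Hz Hw E.
  pose proof (spiral_eq_solve z w Hz Hw E) as Ez.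
  pose proof (spiral_eq_solve w z Hw Hz (eq_sym E)) as Ew.
  cbv zeta in Ez, Ew.
  set (rho := (Clog (1 + z) - Clog (1 + w))%C) in *.
  replace (Clog (1 + w) - Clog (1 + z))%C with (- rho)%C in Ew by (unfold rho; ring).
  replace (Ci * - rho)%C with (- (Ci * rho))%C in Ew by ring.
  assert (Hrho : Rabs (Im rho) <= PI).
  { pose proof (Rabs_Im_Clog (1 + z)). pose proof (Rabs_Im_Clog (1 + w)).
    change (Im rho) with (Im (Clog (1 + z)) - Im (Clog (1 + w))).
    unfold Rminus. eapply Rle_trans; [apply Rabs_triang|]. rewrite Rabs_Ropp. lra. }
  (* The disk condition enters only through this strict inequality, which needs [a <> 0]. *)
  assert (Hlt : forall u a b : C, in_disk u -> (u * a = - b)%C -> a <> 0 -> Cmod b < Cmod a).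
  { intros u a b Hu Eab Ha. apply Cmod_gt_0 in Ha.
    rewrite <- (Cmod_opp b), <- Eab, Cmod_mult. unfold in_disk in Hu. nra. }
  destruct (Ceq_dec rho 0) as [E0|Hn].
  - assert (EL : Clog (1 + z) = Clog (1 + w)).
    { replace (Clog (1 + z)) with (rho + Clog (1 + w))%C by (unfold rho; ring).
      rewrite E0. ring. }
    assert (H : (1 + z = 1 + w)%C).
    { rewrite <- (Cexp_Clog _ (Re_one_plus_pos z Hz)), EL.
      apply Cexp_Clog, Re_one_plus_pos, Hw. }
    replace z with (1 + z - 1)%C by ring. rewrite H. ring.
  - exfalso.
    (* It remains to see that the factors multiplying [z] and [w] do not vanish. If [e^(i rho) = 1],
       the solved equation gives [e^rho = 1] as well; moduli then show that both [Re rho] and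
       [Im rho] are 0. The same works for [- rho]. *)
    assert (Hm : forall r : C, Cexp r = 1 -> Re r = 0).
    { intros r Hr. apply exp_inv. rewrite exp_0, <- Cmod_Cexp, Hr. apply Cmod_1. }
    assert (Hmin : forall a : C, (a - 1 = 0)%C -> a = 1).
    { intros a Ha. replace a with (a - 1 + 1)%C by ring. rewrite Ha. ring. }
    assert (Hopp : forall a : C, (- a = 0)%C -> a = 0).
    { intros a Ha. replace a with (- - a)%C by ring. rewrite Ha. ring. }
    assert (H0 : forall r : C, Cexp r = 1 -> Cexp (Ci * r) = 1 -> r = 0).
    { intros r Ha Hb. apply Hm in Ha. apply Hm in Hb.
      destruct r as [x y]. simpl in *. unfold RtoC. f_equal; lra. }
    apply (rotate_exponent_not_both_larger rho Hrho).
    + apply (Hlt z _ _ Hz Ez). intros Ha. apply Hn.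
      apply H0; [|now apply Hmin].
      apply Hmin. rewrite Ha, Cmult_0_r in Ez.
      now apply Hopp.
    + apply (Hlt w _ _ Hw Ew). intros Ha. apply Hn.
      apply Hopp.
      apply H0; [|apply Hmin; now replace (Ci * - rho)%C with (- (Ci * rho))%C by ring].
      apply Hmin. rewrite Ha, Cmult_0_r in Ew.
      now apply Hopp.
Qed.

(** The coefficient [m] may stay unspecified: analyticity needs only existence, and the
    normalization at 0 kills the term [z * m]. *)
Lemma Cder_spiral (z : C) :
  in_disk z ->
  exists m, Cder spiral z (Cexp ((Ci - 1) * Clog (1 + z)) + z * m)%C.
Proof.
  intros Hz. eexists. eapply Cder_eq.
  - apply Cder_mult; [apply Cder_id|].
    apply (Cder_comp (fun x => Cexp ((Ci - 1) * Clog x)) (fun x => 1 + x)%C).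
    + apply Cder_Cpow, Re_one_plus_pos, Hz.
    + apply Cder_plus; [apply Cder_const|apply Cder_id].
  - cbv beta. rewrite Cmult_1_l. reflexivity.
Qed.

Lemma Clog_1 : Clog 1 = 0.
Proof.
  unfold Clog. rewrite Cmod_1, ln_1. simpl.
  unfold Rdiv. rewrite Rmult_0_l, atan_0. reflexivity.
Qed.

Lemma classS_spiral : classS spiral.
Proof.
  split; [split; [|split]|].
  - intros z Hz. destruct (Cder_spiral z Hz) as [m Hm].
    eexists. apply is_derive_Cder. exact Hm.
  - unfold spiral. ring.
  - apply is_derive_Cder.
    assert (H0 : in_disk 0) by (unfold in_disk; rewrite Cmod_0; lra).
    destruct (Cder_spiral 0 H0) as [m Hm]. eapply Cder_eq; [exact Hm|].
    rewrite Cplus_0_r, Clog_1, Cmult_0_r, Cexp_0. ring.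
  - exact spiral_injective.
Qed.

(** * Mean value inequality and contractions *)

Lemma Cder_Re (P : C -> C) (t : R) (m : C) :
  Cder P t m -> is_derive (fun s : R => Re (P s)) t (Re m).
Proof.
  rewrite Cder_eps. intros H. apply is_derive_Reals. intros eps He.
  destruct (H (mkposreal (eps / 2) ltac:(lra))) as [d Hd]. simpl in Hd.
  exists d. intros h Hh Hhd.
  assert (Eh : (RtoC (t + h) - RtoC t)%C = RtoC h) by (rewrite <- RtoC_minus; f_equal; ring).
  specialize (Hd (RtoC (t + h))). rewrite Eh, Cmod_R in Hd. specialize (Hd Hhd).
  pose proof (Rle_trans _ _ _ (re_le_Cmod _) Hd) as H1.
  replace (Re (P (RtoC (t + h)) - P (RtoC t) - RtoC h * m)%C)
    with (((Re (P (RtoC (t + h))) - Re (P (RtoC t))) / h - Re m) * h) in H1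
    by (unfold Re; simpl; field; exact Hh).
  rewrite Rabs_mult in H1. pose proof (Rabs_pos_lt h Hh).
  apply Rmult_le_reg_r in H1; lra.
Qed.

(** With [D = P z1 - P z0], the real mean value theorem is applied to the real part of [Cconj D * P]
    along the segment. Its increment is [|D|^2], so one factor [|D|] cancels unless [D = 0]. *)
Lemma Cmean_value (P dP : C -> C) (z0 z1 : C) (M : R) :
  (forall t : R, 0 <= t <= 1 ->
     Cder P (z0 + t * (z1 - z0))%C (dP (z0 + t * (z1 - z0))%C) /\
     Cmod (dP (z0 + t * (z1 - z0))%C) <= M) ->
  Cmod (P z1 - P z0)%C <= M * Cmod (z1 - z0)%C.
Proof.
  intros H.
  set (D := (P z1 - P z0)%C).
  set (g := fun s : C => (Cconj D * P (z0 + s * (z1 - z0)))%C).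
  set (dg := fun s : C => (Cconj D * ((z1 - z0) * dP (z0 + s * (z1 - z0))))%C).
  assert (Hg : forall t : R, 0 <= t <= 1 -> Cder g t (dg t)).
  { intros t Ht. eapply Cder_eq.
    - apply Cder_mult; [apply Cder_const|].
      apply (Cder_comp P (fun s => z0 + s * (z1 - z0))%C); [exact (proj1 (H t Ht))|].
      apply Cder_plus; [apply Cder_const|].
      apply Cder_mult; [apply Cder_id|apply Cder_const].
    - unfold dg. cbv beta. ring. }
  destruct (MVT_gen (fun t : R => Re (g t)) 0 1 (fun t : R => Re (dg t))) as [c [Hc E]];
    rewrite ?(Rmin_left 0 1), ?(Rmax_right 0 1) in * by lra.
  - intros t Ht. apply Cder_Re, Hg. lra.
  - intros t Ht. apply derivable_continuous_pt. exists (Re (dg t)).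
    apply is_derive_Reals, Cder_Re, Hg, Ht.
  - assert (E1 : Re (g 1) - Re (g 0) = Cmod D ^ 2).
    { unfold g. replace (z0 + 1 * (z1 - z0))%C with z1 by ring.
      replace (z0 + 0 * (z1 - z0))%C with z0 by ring.
      replace (Re (Cconj D * P z1) - Re (Cconj D * P z0)) with (Re (D * Cconj D)%C)
        by (unfold D, Re; simpl; ring).
      rewrite <- Cmod2_conj. reflexivity. }
    rewrite E1 in E.
    assert (H2 : Re (dg c) <= Cmod D * (Cmod (z1 - z0) * M)).
    { eapply Rle_trans; [apply Rle_abs|]. eapply Rle_trans; [apply re_le_Cmod|].
      unfold dg. rewrite !Cmod_mult, Cmod_conj.
      apply Rmult_le_compat_l; [apply Cmod_ge_0|].
      apply Rmult_le_compat_l; [apply Cmod_ge_0|]. apply (H c Hc). }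
    destruct (Cmod_ge_0 D) as [HD|HD].
    + apply (Rmult_le_reg_l (Cmod D)); [exact HD|]. nra.
    + rewrite <- HD. apply Rmult_le_pos; [|apply Cmod_ge_0].
      eapply Rle_trans; [apply Cmod_ge_0|]. apply (proj2 (H 0 ltac:(lra))).
Qed.

Lemma Cmod_minus_sym (a b : C) : Cmod (a - b)%C = Cmod (b - a)%C.
Proof. rewrite <- Cmod_opp. f_equal. ring. Qed.

Lemma Cmod_triangle_minus (a b c : C) : Cmod (a - c)%C <= Cmod (a - b)%C + Cmod (b - c)%C.
Proof. replace (a - c)%C with ((a - b) + (b - c))%C by ring. apply Cmod_triangle. Qed.

(** Banach iteration from 0: the iterates stay in the closed disk because [|T x| <= |T x - T 0| + |T
    0| <= r/2 + r/2]. *)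
Lemma contraction_fixed_point (T : C -> C) (r : R) :
  Cmod (T 0) <= r / 2 ->
  (forall a b, Cmod a <= r -> Cmod b <= r -> Cmod (T a - T b)%C <= / 2 * Cmod (a - b)%C) ->
  exists x, Cmod x <= r /\ T x = x.
Proof.
  intros H0 HT.
  assert (Hr : 0 <= r) by (pose proof (Cmod_ge_0 (T 0)); lra).
  set (u := fun n => Nat.iter n T (RtoC 0)).
  assert (Hu : forall n, Cmod (u n) <= r).
  { induction n as [|n IH]; [simpl; rewrite Cmod_0; exact Hr|].
    change (u (S n)) with (T (u n)).
    pose proof (HT (u n) 0 IH ltac:(rewrite Cmod_0; exact Hr)) as H.
    replace (u n - 0)%C with (u n) in H by ring.
    replace (T (u n)) with (T (u n) - T 0 + T 0)%C by ring.
    eapply Rle_trans; [apply Cmod_triangle|]. lra. }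
  assert (Hd : forall n, Cmod (u (S n) - u n)%C <= r * (/ 2) ^ n).
  { induction n as [|n IH].
    - simpl. replace (T 0 - 0)%C with (T 0) by ring. lra.
    - eapply Rle_trans; [apply (HT (u (S n)) (u n)); apply Hu|]. simpl pow. lra. }
  destruct (ex_series_le (V := C_R_CompleteNormedModule)
              (fun n => u (S n) - u n)%C (fun n => r * (/ 2) ^ n)) as [l Hl].
  { intros n. rewrite <- Cmod_norm. apply Hd. }
  { apply (ex_series_scal (K := R_AbsRing) (V := R_NormedModule)).
    apply ex_series_geom. rewrite Rabs_pos_eq; lra. }
  (* Convergence of the series of increments is convergence of the iterates, since the sum
     telescopes from [u 0 = 0]; the sum up to [n] is [u (S n)]. *)
  assert (Hs : forall n, sum_n (G := C_AbelianMonoid) (fun n => u (S n) - u n)%C n = u (S n)).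
  { induction n as [|n IH].
    - rewrite sum_O. simpl. ring.
    - rewrite sum_Sn, IH. change (u (S n) + (u (S (S n)) - u (S n)) = u (S (S n)))%C. ring. }
  assert (Hlim : forall eps, 0 < eps -> exists N, forall n, (N <= n)%nat -> Cmod (u (S n) - l)%C < eps).
  { intros eps He.
    (* Balls of [C] are taken componentwise, which costs a factor [sqrt 2] in the modulus. *)
    assert (Hs2 : 0 < sqrt 2) by (apply sqrt_lt_R0; lra).
    assert (He' : 0 < eps / sqrt 2) by now apply Rdiv_lt_0_compat.
    destruct (proj1 (filterlim_locally _ _) Hl (mkposreal _ He')) as [N HN].
    exists N. intros n Hn. specialize (HN n Hn).
    apply C_NormedModule_mixin_compat2 in HN. simpl pos in HN.
    replace (sqrt 2 * (eps / sqrt 2)) with eps in HN by (field; lra).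
    rewrite <- (Hs n). exact HN. }
  assert (Hlr : Cmod l <= r).
  { apply le_epsilon. intros eps He. destruct (Hlim eps He) as [N HN].
    specialize (HN N (le_n N)). rewrite Cmod_minus_sym in HN.
    replace l with (l - u (S N) + u (S N))%C by ring.
    eapply Rle_trans; [apply Cmod_triangle|]. pose proof (Hu (S N)). lra. }
  exists l. split; [exact Hlr|].
  enough (H : Cmod (T l - l)%C <= 0).
  { assert (E : (T l - l)%C = 0).
    { apply Cmod_eq_0. pose proof (Cmod_ge_0 (T l - l)%C). lra. }
    replace (T l) with (T l - l + l)%C by ring. rewrite E. ring. }
  apply le_epsilon. intros eps He. destruct (Hlim (eps / 2) ltac:(lra)) as [N HN].
  pose proof (HN N (le_n N)) as H1. pose proof (HN (S N) (le_S _ _ (le_n N))) as H2.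
  pose proof (Cmod_triangle_minus (T l) (T (u (S N))) l) as H3.
  pose proof (HT l (u (S N)) Hlr (Hu _)) as H4.
  rewrite (Cmod_minus_sym l) in H4. change (u (S (S N))) with (T (u (S N))) in H2. lra.
Qed.

(** * The derivative of the transform *)

(** The integrand [(1 + w)^(i-1) (1 - w)^(-beta)] with the factor [w] cancelled, hence regular at
    0. *)
Definition spiral_density (beta : R) (w : C) : C :=
  (Cexp ((Ci - 1) * Clog (1 + w)) * Cexp (- RtoC beta * Clog (1 - w)))%C.

Lemma Re_one_minus_pos (z : C) : in_disk z -> 0 < Re (1 - z)%C.
Proof.
  unfold in_disk. intros H. apply (Re_pos_open 1). simpl.
  replace (1 - z - 1)%C with (- z)%C by ring. rewrite Cmod_opp. exact H.
Qed.

Lemma Cder_spiral_density (beta : R) (w : C) :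
  in_disk w -> exists m, Cder (spiral_density beta) w m.
Proof.
  intros Hw. eexists. apply Cder_mult.
  - apply (Cder_comp (fun x => Cexp ((Ci - 1) * Clog x)) (fun x => 1 + x)%C).
    + apply Cder_Cpow, Re_one_plus_pos, Hw.
    + apply Cder_plus; [apply Cder_const|apply Cder_id].
  - apply (Cder_comp (fun x => Cexp (- RtoC beta * Clog x)) (fun x => 1 - x)%C).
    + apply Cder_Cpow, Re_one_minus_pos, Hw.
    + apply Cder_minus; [apply Cder_const|apply Cder_id].
Qed.

Lemma Cbeta_integrand_spiral (beta : R) (w : C) :
  w <> 0 -> Cbeta_integrand beta spiral w = spiral_density beta w.
Proof.
  intros Hw. unfold Cbeta_integrand, spiral_density, spiral.
  rewrite cpow_pr_Cexp.
  replace (Cexp (- RtoC beta * Clog (1 - w))) with (/ Cexp (beta * Clog (1 - w)))%C.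
  - field. split; [apply Cexp_neq_0|exact Hw].
  - assert (E : (Cexp (beta * Clog (1 - w)) * Cexp (- RtoC beta * Clog (1 - w)) = 1)%C).
    { rewrite <- Cexp_plus, <- Cexp_0. f_equal. ring. }
    pose proof (Cexp_neq_0 (beta * Clog (1 - w))) as Hn. revert E Hn.
    generalize (Cexp (beta * Clog (1 - w))) (Cexp (- RtoC beta * Clog (1 - w))).
    intros a b E Hn. replace b with (/ a * (a * b))%C by (field; exact Hn).
    rewrite E. ring.
Qed.

Lemma Cder_continuous (P : C -> C) (t : R) (m : C) :
  Cder P t m ->
  continuous (T := R_UniformSpace) (U := C_R_NormedModule) (fun s : R => P s) t.
Proof.
  intros H. apply filterlim_locally. intros eps.
  destruct (Cder_continuity P t m H eps (cond_pos eps)) as [d [Hd E]].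
  exists (mkposreal d Hd). intros s Hs.
  apply C_NormedModule_mixin_compat1. apply (E (RtoC s)).
  rewrite <- RtoC_minus, Cmod_R. exact Hs.
Qed.

Lemma continuous_ray_density (beta : R) (z : C) (t : R) :
  in_disk (t * z)%C ->
  continuous (T := R_UniformSpace) (U := C_R_NormedModule)
    (fun s : R => (spiral_density beta (s * z) * z)%C) t.
Proof.
  intros H. destruct (Cder_spiral_density beta _ H) as [m Hm].
  eapply (Cder_continuous (fun s => spiral_density beta (s * z) * z)%C).
  apply Cder_mult; [|apply Cder_const].
  apply (Cder_comp _ (fun s => s * z)%C); [exact Hm|].
  apply Cder_mult; [apply Cder_id|apply Cder_const].
Qed.

Lemma ex_RInt_ray_density (beta : R) (z : C) (t : R) :
  0 <= t -> in_disk (t * z)%C ->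
  ex_RInt (V := C_R_NormedModule) (fun s : R => (spiral_density beta (s * z) * z)%C) 0 t.
Proof.
  intros Ht H. apply (ex_RInt_continuous (V := C_R_CompleteNormedModule)).
  intros s. rewrite Rmin_left, Rmax_right by exact Ht. intros Hs.
  apply continuous_ray_density. unfold in_disk in *.
  rewrite Cmod_mult, Cmod_R, Rabs_pos_eq in * by lra.
  eapply Rle_lt_trans; [|exact H]. apply Rmult_le_compat_r; [apply Cmod_ge_0|lra].
Qed.

(** The substitution [s -> t s] moves the dependence on [t] into the upper limit, so that the
    integral can be differentiated along the ray. *)
Lemma Cbeta_spiral_ray (beta : R) (z : C) (t : R) :
  z <> 0 -> 0 < t -> in_disk (t * z)%C ->
  Cbeta beta spiral (t * z) =
  RInt (V := C_R_CompleteNormedModule)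
    (fun s : R => (spiral_density beta (s * z) * z)%C) 0 t.
Proof.
  intros Hz Ht H. unfold Cbeta.
  transitivity (RInt (V := C_R_CompleteNormedModule)
    (fun y => scal t ((fun s : R => (spiral_density beta (s * z) * z)%C) (t * y + 0))) 0 1).
  (* Only the open interval is compared, so the quotient by [w] is never evaluated at [w = 0]. *)
  - apply (RInt_ext (V := C_R_CompleteNormedModule)). rewrite Rmin_left, Rmax_right by lra. intros s Hs.
    rewrite Cbeta_integrand_spiral.
    + rewrite Rplus_0_r.
      replace (RtoC s * (RtoC t * z))%C with (RtoC (t * s) * z)%C by (rewrite RtoC_mult; ring).
      generalize (spiral_density beta (RtoC (t * s) * z)). intros [a b].
      destruct z as [x y]. unfold scal; simpl. unfold prod_scal, scal; simpl.
      unfold mult, Cmult, RtoC; simpl. f_equal; ring.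
    + repeat apply Cmult_neq_0; try exact Hz; intros E; injection E; lra.
  - assert (E0 : t * 0 + 0 = 0) by ring. assert (E1 : t * 1 + 0 = t) by ring.
    etransitivity; [apply (RInt_comp_lin (V := C_R_CompleteNormedModule)
      (fun s : R => (spiral_density beta (s * z) * z)%C) t 0 0 1)|];
      rewrite E0, E1; [|reflexivity].
    apply ex_RInt_ray_density; [lra|exact H].
Qed.

Lemma is_derive_ray_eps (g : R -> C) (t : R) (l : C) :
  is_derive (K := R_AbsRing) (V := C_R_NormedModule) g t l ->
  forall eps, 0 < eps -> exists d, 0 < d /\ forall h : R, Rabs h < d ->
    Cmod (g (t + h)%R - g t - h * l)%C <= eps * Rabs h.
Proof.
  intros [_ H] eps He.
  destruct (H t (fun P HP => HP) (mkposreal eps He)) as [d Hd].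
  exists d. split; [apply cond_pos|]. intros h Hh.
  assert (Hb : ball (M := R_UniformSpace) t d (t + h)).
  { unfold ball; simpl. unfold AbsRing_ball, abs, minus, plus, opp; simpl.
    replace (t + h + - t) with h by ring. exact Hh. }
  specialize (Hd _ Hb). rewrite <- Cmod_norm in Hd. simpl pos in Hd.
  change (norm (minus (t + h) t)) with (Rabs (t + h + - t)) in Hd.
  replace (t + h + - t) with h in Hd by ring.
  replace (g (t + h)%R - g t - h * l)%C
    with (minus (minus (g (t + h)) (g t)) (scal (V := C_R_NormedModule) (minus (t + h) t) l));
    [exact Hd|].
  destruct l as [a b], (g (t + h)) as [p q], (g t) as [u v].
  unfold minus, plus, opp, scal; simpl. unfold prod_plus, prod_opp, prod_scal; simpl.
  unfold Cminus, Cplus, Copp, Cmult, plus, opp, scal; simpl. unfold mult; simpl. f_equal; ring.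
Qed.

(* The ray derivative identifies the complex derivative once the latter is known to exist,
   so path independence of the integral is never needed. *)
Lemma Cder_Cbeta_spiral (beta : R) (z : C) :
  analytic_on_disk (Cbeta beta spiral) -> in_disk z -> z <> 0 ->
  Cder (Cbeta beta spiral) z (spiral_density beta z).
Proof.
  intros Ha Hz Hz0.
  destruct (Ha z Hz) as [l Hl]. apply is_derive_Cder in Hl.
  eapply Cder_eq; [exact Hl|].
  set (G := Cbeta beta spiral) in *.
  set (p := fun s : R => (spiral_density beta (s * z) * z)%C).
  pose proof (proj1 (Cmod_gt_0 z) Hz0) as Hm. unfold in_disk in Hz.
  (* For [|t - 1| < r], the factor [t] stays positive and [t z] stays in the disk. *)
  set (r := Rmin (1 / 2) (/ Cmod z - 1)).
  assert (Hr : 0 < r).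
  { apply Rmin_pos; [lra|]. pose proof (Rinv_lt_contravar (Cmod z) 1 ltac:(lra) Hz). lra. }
  assert (Hr1 : r <= 1 / 2) by apply Rmin_l.
  assert (Hr2 : r <= / Cmod z - 1) by apply Rmin_r.
  assert (Hray : forall t, Rabs (t - 1) < r -> 0 < t /\ in_disk (t * z)%C).
  { intros t Ht. apply Rabs_def2 in Ht. split; [lra|].
    unfold in_disk. rewrite Cmod_mult, Cmod_R, Rabs_pos_eq by lra.
    assert (Ht' : t < / Cmod z) by lra.
    apply (Rmult_lt_compat_r (Cmod z)) in Ht'; [|exact Hm].
    rewrite Rinv_l in Ht' by lra. exact Ht'. }
  assert (HI : is_derive (K := R_AbsRing) (V := C_R_NormedModule)
                 (RInt (V := C_R_CompleteNormedModule) p 0) 1 (p 1)).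
  { apply (is_derive_RInt (V := C_R_NormedModule) p _ 0 1).
    - exists (mkposreal r Hr). intros t Ht. destruct (Hray t Ht) as [Ht0 Htd].
      apply (RInt_correct (V := C_R_CompleteNormedModule)).
      exact (ex_RInt_ray_density beta z t (Rlt_le _ _ Ht0) Htd).
    - apply (continuous_ray_density beta z 1). apply (Hray 1).
      rewrite Rminus_diag, Rabs_R0. exact Hr. }
  assert (Hline : Cder (fun s => G (s * z))%C (RtoC 1) (z * l)%C).
  { eapply Cder_eq.
    - apply (Cder_comp G (fun s => s * z)%C).
      + rewrite Cmult_1_l. exact Hl.
      + apply Cder_mult; [apply Cder_id|apply Cder_const].
    - cbv beta. ring. }
  (* [p 1] and [z * l] are both derivatives of [G (s z)] at [s = 1], by [HI] and by the chain rule.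
     Comparing them on one small increment [h] bounds their distance by any [eps]. *)
  enough (E : Cmod (p 1 - z * l)%C <= 0).
  { assert (E1 : (p 1 - z * l)%C = 0).
    { apply Cmod_eq_0. pose proof (Cmod_ge_0 (p 1 - z * l)%C). lra. }
    unfold p in E1. rewrite Cmult_1_l in E1.
    replace l with ((spiral_density beta z * z - (spiral_density beta z * z - z * l)) / z)%C
      by (field; exact Hz0).
    rewrite E1. field. exact Hz0. }
  apply le_epsilon. intros eps He. rewrite Rplus_0_l.
  destruct (is_derive_ray_eps _ _ _ HI (eps / 2) ltac:(lra)) as [d1 [Hd1 E1]].
  destruct (proj1 (Cder_eps _ _ _) Hline (mkposreal (eps / 2) ltac:(lra))) as [d2 E2].
  simpl pos in E2.
  set (h := Rmin r (Rmin d1 d2) / 2).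
  assert (Hh : 0 < Rmin r (Rmin d1 d2)).
  { apply Rmin_pos; [exact Hr|apply Rmin_pos; [exact Hd1|apply cond_pos]]. }
  pose proof (Rmin_l r (Rmin d1 d2)). pose proof (Rmin_r r (Rmin d1 d2)).
  pose proof (Rmin_l d1 d2). pose proof (Rmin_r d1 d2).
  assert (Hh0 : 0 < h) by (unfold h; lra).
  assert (Hha : Rabs h = h) by (apply Rabs_pos_eq; lra).
  specialize (E1 h ltac:(rewrite Hha; unfold h; lra)).
  specialize (E2 (RtoC (1 + h))).
  assert (Eh : (RtoC (1 + h) - RtoC 1)%C = RtoC h) by (rewrite <- RtoC_minus; f_equal; ring).
  rewrite Eh, Cmod_R, Hha in E2. specialize (E2 ltac:(unfold h; lra)).
  rewrite Hha in E1.
  assert (HG : forall t, Rabs (t - 1) < r -> G (RtoC t * z)%C = RInt (V := C_R_CompleteNormedModule) p 0 t).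
  { intros t Ht. destruct (Hray t Ht). now apply Cbeta_spiral_ray. }
  rewrite (HG (1 + h)), (HG 1) in E2
    by (rewrite ?Rminus_diag, ?Rabs_R0; try exact Hr;
        replace (1 + h - 1) with h by ring; rewrite Hha; unfold h; lra).
  set (D := (RInt (V := C_R_CompleteNormedModule) p 0 (1 + h)%R
             - RInt (V := C_R_CompleteNormedModule) p 0 1)%C) in *.
  assert (E3 : Cmod (RtoC h * (p 1 - z * l))%C <= eps * h).
  { replace (RtoC h * (p 1 - z * l))%C
      with ((D - RtoC h * (z * l)) + - (D - RtoC h * p 1))%C by ring.
    eapply Rle_trans; [apply Cmod_triangle|]. rewrite Cmod_opp. lra. }
  rewrite Cmod_mult, Cmod_R, Hha in E3. nra.
Qed.

(** * Failure of univalence *)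

Lemma exp_quarter_le (x : R) : x <= 1 / 4 -> exp x <= 4 / 3.
Proof.
  intros Hx. pose proof (exp_ineq1_le (- x)) as H. rewrite exp_Ropp in H.
  pose proof (exp_pos x).
  apply (Rmult_le_compat_l (exp x)) in H; [|lra]. rewrite Rinv_r in H by lra. nra.
Qed.

(** Since [cosh + cos >= 2], one has [cos y >= 2 - cosh y], and [cosh y <= (4/3 + 1)/2]. *)
Lemma cos_quarter_gt (y : R) : Rabs y <= 1 / 4 -> 1 / 2 < cos y.
Proof.
  intros Hy. pose proof (cosh_plus_cos_le 0 (Rabs y) (Rle_refl 0) (Rabs_pos y)) as H.
  rewrite cosh_0, cos_0, cos_Rabs in H. unfold cosh in H.
  pose proof (exp_quarter_le (Rabs y) Hy).
  assert (exp (- Rabs y) <= 1).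
  { rewrite <- exp_0. pose proof (Rabs_pos y).
    destruct (Req_dec (Rabs y) 0) as [->|]; [rewrite Ropp_0; lra|].
    left. apply exp_increasing. lra. }
  lra.
Qed.

(** For [L = x + iy], [|e^L - 1|^2 = 1 + e^x (e^x - 2 cos y)], where [e^x < 1 < 2 cos y]. *)
Lemma Cexp_minus_1_in_disk (L : C) :
  Re L < 0 -> Rabs (Im L) <= 1 / 4 -> in_disk (Cexp L - 1)%C.
Proof.
  destruct L as [x y]. simpl. intros Hx Hy. unfold in_disk.
  pose proof (Cmod2_Cexp_minus_1 x y) as H. unfold cosh in H. rewrite exp_Ropp in H.
  pose proof (cos_quarter_gt y Hy). pose proof (exp_pos x).
  assert (exp x < 1) by (rewrite <- exp_0; now apply exp_increasing).
  replace (2 * exp x * ((exp x + / exp x) / 2 - cos y))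
    with (1 + exp x * (exp x - 2 * cos y)) in H by (field; lra).
  pose proof (Cmod_ge_0 (Cexp (x, y) - 1)%C). nra.
Qed.

Lemma Cexp_minus_1_neq_0 (L : C) : Re L < 0 -> (Cexp L - 1)%C <> 0.
Proof.
  intros HL E.
  assert (E1 : Cexp L = 1%C) by (replace (Cexp L) with (Cexp L - 1 + 1)%C by ring; rewrite E; ring).
  pose proof (Cmod_Cexp L) as H. rewrite E1, Cmod_1 in H.
  apply exp_increasing in HL. rewrite exp_0 in HL. lra.
Qed.

(** The factor [(1 - z)^(-beta)] as a function of [s = 1 + z]. *)
Definition outer_factor (beta : R) (s : C) : C := Cexp (- RtoC beta * Clog (2 - s)).

(* In the coordinate [L] = log(1 + z) the derivative of [Cbeta beta spiral] becomes
   [exp(iL)] times a factor that is nearly constant for [Re L] very negative. *)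
Lemma Cder_Cbeta_spiral_log (beta : R) (L : C) :
  analytic_on_disk (Cbeta beta spiral) -> Re L < 0 -> Rabs (Im L) <= 1 / 4 ->
  Cder (fun x => Cbeta beta spiral (Cexp x - 1))%C L
    (Cexp (Ci * L) * outer_factor beta (Cexp L))%C.
Proof.
  intros Ha Hre Him. eapply Cder_eq.
  - apply (Cder_comp (Cbeta beta spiral) (fun x => Cexp x - 1)%C).
    + apply Cder_Cbeta_spiral; [exact Ha|now apply Cexp_minus_1_in_disk|
        now apply Cexp_minus_1_neq_0].
    + apply Cder_minus; [apply Cder_Cexp|apply Cder_const].
  - unfold spiral_density, outer_factor.
    replace (1 + (Cexp L - 1))%C with (Cexp L) by ring.
    replace (1 - (Cexp L - 1))%C with (2 - Cexp L)%C by ring.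
    rewrite Clog_Cexp by (pose proof PI2_3_2; lra).
    replace (Ci * L)%C with (L + (Ci - 1) * L)%C by ring.
    rewrite (Cexp_plus L). ring.
Qed.

Lemma outer_factor_near_0 (beta eps : R) :
  0 < eps -> exists d, 0 < d /\ forall s, Cmod s < d ->
    Cmod (outer_factor beta s / outer_factor beta 0 - 1)%C <= eps.
Proof.
  intros He.
  assert (Hk : outer_factor beta 0 <> 0) by apply Cexp_neq_0.
  pose proof (proj1 (Cmod_gt_0 _) Hk) as Hm.
  assert (Hd : exists m, Cder (outer_factor beta) 0 m).
  { eexists. apply (Cder_comp (fun x => Cexp (- RtoC beta * Clog x)) (fun s => 2 - s)%C).
    - apply Cder_Cpow. simpl. lra.
    - apply Cder_minus; [apply Cder_const|apply Cder_id]. }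
  destruct Hd as [m Hd].
  destruct (Cder_continuity _ _ _ Hd (eps * Cmod (outer_factor beta 0))) as [d [Hd0 E]].
  { now apply Rmult_lt_0_compat. }
  exists d. split; [exact Hd0|]. intros s Hs.
  specialize (E s). replace (s - 0)%C with s in E by ring. specialize (E Hs).
  replace (outer_factor beta s / outer_factor beta 0 - 1)%C
    with ((outer_factor beta s - outer_factor beta 0) / outer_factor beta 0)%C
    by (field; exact Hk).
  rewrite Cmod_div by exact Hk. apply Rle_div_l; lra.
Qed.

(** The derivative of [e^(ix)] is at most [4/3] in modulus on this disk, and [4/3 * 1/4 = 1/3]. *)
Lemma Cmod_Cexp_Ci_minus_1 (x : C) :
  Cmod x <= 1 / 4 -> Cmod (Cexp (Ci * x) - 1)%C <= 1 / 3.
Proof.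
  intros Hx.
  assert (H : Cmod (Cexp (Ci * x) - Cexp (Ci * 0))%C <= 4 / 3 * Cmod (x - 0)%C).
  { apply (Cmean_value (fun y => Cexp (Ci * y)) (fun y => Ci * Cexp (Ci * y))%C).
    intros t Ht. replace (0 + t * (x - 0))%C with (t * x)%C by ring. split.
    - eapply Cder_eq.
      + apply (Cder_comp Cexp (fun y => Ci * y)%C); [apply Cder_Cexp|].
        apply Cder_mult; [apply Cder_const|apply Cder_id].
      + cbv beta. ring.
    - rewrite Cmod_mult, Cmod_Ci, Rmult_1_l, Cmod_Cexp.
      apply exp_quarter_le.
      eapply Rle_trans; [apply Rle_abs|]. eapply Rle_trans; [apply re_le_Cmod|].
      rewrite !Cmod_mult, Cmod_Ci, Cmod_R, Rabs_pos_eq by lra.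
      pose proof (Cmod_ge_0 x). nra. }
  rewrite Cmult_0_r, Cexp_0 in H. replace (x - 0)%C with x in H by ring. lra.
Qed.

Lemma Cmod_segment_le (a b : C) (t r : R) :
  0 <= t <= 1 -> Cmod a <= r -> Cmod b <= r -> Cmod (a + t * (b - a))%C <= r.
Proof.
  intros Ht Ha Hb.
  replace (a + t * (b - a))%C with ((1 - t)%R * a + t * b)%C by (rewrite RtoC_minus; ring).
  eapply Rle_trans; [apply Cmod_triangle|].
  rewrite !Cmod_mult, !Cmod_R, !Rabs_pos_eq by lra. nra.
Qed.

Lemma Cexp_Ci_period (N : nat) : Cexp (Ci * RtoC (- (2 * INR N * PI))) = 1.
Proof.
  replace (Ci * RtoC (- (2 * INR N * PI)))%C with (0, - (2 * INR N * PI))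
    by (unfold Ci, Cmult, RtoC; simpl; f_equal; ring).
  unfold Cexp; simpl. rewrite exp_0, cos_neg, sin_neg.
  replace (2 * INR N * PI) with (0 + 2 * INR N * PI) by ring.
  rewrite cos_period, sin_period, cos_0, sin_0. unfold RtoC. f_equal; ring.
Qed.

(* [H] behaves like [-i exp(iL)] far to the left, so it nearly has period [2 PI]; the contraction
   [x |-> x - (H (a + x) - H (a - 2 PI))] corrects the error. *)
Lemma almost_periodic_not_injective (H dH : C -> C) (N : nat) :
  let a := - (2 * INR N * PI) in
  (forall L, Re L <= a + 1 / 4 -> Rabs (Im L) <= 1 / 4 ->
     Cder H L (Cexp (Ci * L) * dH L)%C /\ Cmod (dH L - 1)%C <= 1 / 64) ->
  exists x, Cmod x <= 1 / 4 /\ H (a + x)%C = H (RtoC (- (2 * INR (S N) * PI))).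
Proof.
  intros a HH.
  set (b := - (2 * INR (S N) * PI)).
  assert (Hab : b = a - 2 * PI) by (unfold a, b; rewrite S_INR; ring).
  pose proof PI_RGT_0 as HPI. pose proof PI_4 as HPI4.
  set (T := fun x => (x - (H (a + x) - H b))%C).
  destruct (contraction_fixed_point T (1 / 4)) as [x [Hx Ex]].
  (* The derivative of [H + i e^(iL)] is [e^(iL) (dH - 1)], at most [1/64] on the real segment from
     [b] to [a] of length [2 PI <= 8]. The periodic terms cancel, leaving [|T 0| <= 1/8], half the
     radius. *)
  - assert (E : Cmod ((H a + Ci * Cexp (Ci * a)) - (H b + Ci * Cexp (Ci * b)))%C
                <= 1 / 64 * Cmod (RtoC a - RtoC b)%C).
    { apply (Cmean_value (fun L => H L + Ci * Cexp (Ci * L))%C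
               (fun L => Cexp (Ci * L) * (dH L - 1))%C).
      intros t Ht.
      replace (RtoC b + RtoC t * (RtoC a - RtoC b))%C with (RtoC (b + t * (a - b)))
        by (rewrite RtoC_plus, RtoC_mult, RtoC_minus; reflexivity).
      assert (Hle : b + t * (a - b) <= a) by nra.
      destruct (HH (RtoC (b + t * (a - b)))) as [D B].
      { simpl. lra. }
      { simpl. rewrite Rabs_R0. lra. }
      split.
      - eapply Cder_eq.
        + apply Cder_plus; [exact D|]. apply Cder_mult; [apply Cder_const|].
          apply (Cder_comp Cexp (fun y => Ci * y)%C); [apply Cder_Cexp|].
          apply Cder_mult; [apply Cder_const|apply Cder_id].
        + cbv beta.
          generalize (Cexp (Ci * RtoC (b + t * (a - b)))) (dH (RtoC (b + t * (a - b)))).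
          intros u v. transitivity (u * (v + Ci * Ci))%C; [ring|].
          replace (Ci * Ci)%C with (- (1))%C; [ring|].
          unfold Ci, Cmult, Copp, RtoC; simpl. f_equal; ring.
      - rewrite Cmod_mult, Cmod_Cexp.
        replace (Re (Ci * RtoC (b + t * (a - b)))) with 0 by (simpl; ring).
        rewrite exp_0. lra. }
    unfold a, b in E. rewrite !Cexp_Ci_period in E. fold a b in E.
    rewrite <- RtoC_minus, Cmod_R in E.
    replace (a - b) with (2 * PI) in E by (rewrite Hab; ring).
    rewrite Rabs_pos_eq in E by lra.
    unfold T. rewrite Cplus_0_r. rewrite <- Cmod_opp.
    replace (- (0 - (H a - H b)))%C with (H a + Ci * 1 - (H b + Ci * 1))%C by ring.
    lra.
  (* By periodicity [T] has derivative [1 - e^(ip) k] at [p], of modulus at most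
     [1/3 + (4/3)(1/64) < 1/2]. *)
  - intros u v Hu Hv. rewrite (Cmod_minus_sym u v), Cmod_minus_sym.
    apply (Cmean_value T (fun x => 1 - Cexp (Ci * (a + x)) * dH (a + x))%C).
    intros t Ht.
    pose proof (Cmod_segment_le u v t (1 / 4) Ht Hu Hv) as Hp.
    set (p := (u + t * (v - u))%C) in *.
    pose proof (re_le_Cmod p) as Hre. pose proof (Rle_abs (Re p)).
    destruct (HH (a + p)%C) as [D B].
    { change (Re (a + p)%C) with (a + Re p). lra. }
    { change (Im (a + p)%C) with (0 + Im p). rewrite Rplus_0_l.
      eapply Rle_trans; [apply Rabs_Im_le_Cmod|exact Hp]. }
    split.
    + eapply Cder_eq.
      * apply Cder_minus; [apply Cder_id|]. apply Cder_minus; [|apply Cder_const].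
        apply (Cder_comp H (fun y => a + y)%C); [exact D|].
        apply Cder_plus; [apply Cder_const|apply Cder_id].
      * cbv beta. ring.
    + replace (Ci * (a + p))%C with (Ci * a + Ci * p)%C by ring.
      rewrite Cexp_plus. unfold a at 1. rewrite Cexp_Ci_period, Cmult_1_l.
      set (k := dH (a + p)%C) in *.
      replace (1 - Cexp (Ci * p) * k)%C
        with (- (Cexp (Ci * p) - 1) + - (Cexp (Ci * p) * (k - 1)))%C by ring.
      eapply Rle_trans; [apply Cmod_triangle|]. rewrite !Cmod_opp, Cmod_mult, Cmod_Cexp.
      pose proof (Cmod_Cexp_Ci_minus_1 p Hp).
      assert (exp (Re (Ci * p)%C) <= 4 / 3).
      { apply exp_quarter_le. eapply Rle_trans; [apply Rle_abs|].
        eapply Rle_trans; [apply re_le_Cmod|]. rewrite Cmod_mult, Cmod_Ci. lra. }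
      pose proof (exp_pos (Re (Ci * p)%C)). pose proof (Cmod_ge_0 (k - 1)%C). nra.
  - exists x. split; [exact Hx|]. unfold T in Ex.
    replace (H (a + x)%C) with (x - (x - (H (a + x) - H b)) + H b)%C by ring.
    rewrite Ex. ring.
Qed.

(** Assumed membership supplies the analyticity used to differentiate the transform, and the
    injectivity that is then contradicted. *)
Lemma Cbeta_spiral_not_classS (beta : R) : ~ classS (Cbeta beta spiral).
Proof.
  intros [[Ha _] Hinj].
  destruct (outer_factor_near_0 beta (1 / 64) ltac:(lra)) as [d [Hd Ek]].
  set (k0 := outer_factor beta 0) in *.
  assert (Hk : k0 <> 0) by apply Cexp_neq_0.
  pose proof PI2_3_2 as HPI.
  (* This size of [N] puts [a + 1/4] below [ln d], so [|e^L| < d] whenever [Re L <= a + 1/4]. *)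
  destruct (INR_unbounded (Rabs (ln d) + 1)) as [N HN].
  pose proof (Rle_abs (- ln d)) as Hln. rewrite Rabs_Ropp in Hln. pose proof (Rabs_pos (ln d)).
  set (a := - (2 * INR N * PI)).
  assert (Haneg : a + 1 / 4 < ln d /\ a + 1 / 4 < 0) by (unfold a; nra).
  (* Dividing by [k0], the limit of the outer factor, makes the factor of [e^(iL)] close to 1. *)
  destruct (almost_periodic_not_injective
              (fun L => Cbeta beta spiral (Cexp L - 1) / k0)%C
              (fun L => outer_factor beta (Cexp L) / k0)%C N) as [x [Hx E]].
  - fold a. intros L HL HL'. split.
    + eapply Cder_eq.
      * apply Cder_mult; [|apply Cder_const].
        apply Cder_Cbeta_spiral_log; [exact Ha|lra|exact HL'].
      * cbv beta. unfold Cdiv. ring.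
    + apply Ek. rewrite Cmod_Cexp. rewrite <- (exp_ln d Hd). apply exp_increasing. lra.
  - fold a in E. set (b := - (2 * INR (S N) * PI)) in E.
    assert (Hab : b = a - 2 * PI) by (unfold a, b; rewrite S_INR; ring).
    pose proof (Rle_trans _ _ _ (re_le_Cmod x) Hx) as Hre.
    apply Rabs_le_between in Hre.
    (* Injectivity identifies the two disk points; comparing moduli gives [a + Re x = a - 2 PI],
       against [|Re x| <= 1/4]. *)
    assert (E1 : (Cexp (a + x) - 1 = Cexp b - 1)%C).
    { apply Hinj.
      - apply Cexp_minus_1_in_disk.
        + change (Re (a + x)%C) with (a + Re x). lra.
        + change (Im (a + x)%C) with (0 + Im x). rewrite Rplus_0_l.
          eapply Rle_trans; [apply Rabs_Im_le_Cmod|exact Hx].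
      - apply Cexp_minus_1_in_disk; simpl; [lra|rewrite Rabs_R0; lra].
      - replace (Cbeta beta spiral (Cexp (a + x) - 1))%C
          with (Cbeta beta spiral (Cexp (a + x) - 1) / k0 * k0)%C by (field; exact Hk).
        rewrite E. field. exact Hk. }
    assert (E2 : Cexp (a + x) = Cexp b).
    { replace (Cexp (a + x)) with (Cexp (a + x) - 1 + 1)%C by ring. rewrite E1. ring. }
    apply (f_equal Cmod) in E2. rewrite !Cmod_Cexp in E2. apply exp_inv in E2.
    change (a + Re x = b) in E2. lra.
Qed.

Theorem theorem2p18 :
  forall beta : R, 0 <= beta ->
  exists f : C -> C, classS f /\ ~ classS (Cbeta beta f).
Proof.
  intros beta _. exists spiral.
  split; [exact classS_spiral|exact (Cbeta_spiral_not_classS beta)].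
Qed.
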